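(* Let $z>0$ and, for $n\ge 0$, let $u_{n}(z)=\int_{-z}^{z}x^{2n}e^{-x^{2}}\,dx$. Then $u_n=u_n(z)$ satisfies, for all $n\ge 0$, the recurrence equation $$2u_{n+2}-\left(2n+3+2z^{2}\right)u_{n+1}+(2n+1)z^{2}u_{n}=0,$$ with initial conditions $$u_{0}=\sqrt{\pi}\,\operatorname{erf}(z),\qquad u_{1}=\frac{\sqrt{\pi}}{2}\operatorname{erf}(z)-ze^{-z^{2}}.$$
   Context: $\operatorname{erf}(z)=\frac{2}{\sqrt{\pi}}\int_{0}^{z}e^{-x^{2}}dx$ is the error function. The numbers $u_n(z)$ are the even moments of the truncated Hermite linear functional $L[p]=\int_{-z}^{z}p(x)e^{-x^{2}}dx$. *)

(* Defs.v *)
From Stdlib Require Import Reals.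
From Coquelicot Require Import Coquelicot.
Open Scope R_scope.

Definition erf (z : R) : R :=
  2 / sqrt PI * RInt (fun x => exp (- (x ^ 2))) 0 z.

(** [trunc_hermite z p] is the truncated Hermite linear functional [L[p]]. The
    total operator [RInt] is a genuine Riemann integral whenever [p] is
    continuous, in particular for polynomials. *)
Definition trunc_hermite (z : R) (p : R -> R) : R :=
  RInt (fun x => p x * exp (- (x ^ 2))) (- z) z.

Definition u (n : nat) (z : R) : R :=
  trunc_hermite z (fun x => x ^ (2 * n)).

(* Main.v *)
Require Import Defs.
From Stdlib Require Import Reals Lra Lia.
From Coquelicot Require Import Coquelicot.
Open Scope R_scope.

(** Integrating the derivative of [x ^ (2n+1) * exp (- x ^ 2)] over [[-z, z]]
    gives the first-order inhomogeneous recurrence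
    [2 u_(n+1) - (2n+1) u_n = - 2 z ^ (2n+1) exp (- z ^ 2)]. Its right-hand side
    is multiplied by [z ^ 2] when [n] increases by one, so eliminating it gives
    the homogeneous second-order recurrence. *)

Lemma continuous_pow_gauss (m : nat) (x : R) :
  continuous (fun x => x ^ m * exp (- (x ^ 2))) x.
Proof.
apply (ex_derive_continuous (fun x => x ^ m * exp (- (x ^ 2)))).
auto_derive; exact I.
Qed.

Lemma ex_RInt_pow_gauss (m : nat) (a b : R) :
  ex_RInt (fun x => x ^ m * exp (- (x ^ 2))) a b.
Proof.
apply (ex_RInt_continuous (V := R_CompleteNormedModule)).
intros x _; apply continuous_pow_gauss.
Qed.

Lemma is_derive_odd_pow_gauss (n : nat) (x : R) :
  is_derive (fun x => x ^ (2 * n + 1) * exp (- (x ^ 2))) x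
    ((2 * INR n + 1) * (x ^ (2 * n) * exp (- (x ^ 2)))
       - 2 * (x ^ (2 * (n + 1)) * exp (- (x ^ 2)))).
Proof.
auto_derive; [exact I|].
change (n + (n + 0))%nat with (2 * n)%nat.
replace (Nat.pred (2 * n + 1)) with (2 * n)%nat by lia.
replace (2 * (n + 1))%nat with (2 * n + 2)%nat by lia.
rewrite !pow_add, plus_INR, mult_INR; simpl (INR 1); simpl (INR 2).
change (x * (x * 1)) with (x ^ 2); ring.
Qed.

Lemma u_step (n : nat) (z : R) :
  2 * u (n + 1) z
  = (2 * INR n + 1) * u n z - 2 * z ^ (2 * n + 1) * exp (- (z ^ 2)).
Proof.
set (g := fun x => x ^ (2 * n + 1) * exp (- (x ^ 2))).
(* The same integral is evaluated twice, by the fundamental theorem of calculus and by linearity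
   ([Hlin]); uniqueness of the integral then equates the two values. *)
assert (Hftc : is_RInt (fun x => (2 * INR n + 1) * (x ^ (2 * n) * exp (- (x ^ 2)))
    - 2 * (x ^ (2 * (n + 1)) * exp (- (x ^ 2)))) (- z) z (minus (g z) (g (- z)))).
{ apply (is_RInt_derive g); intros x _.
  - apply is_derive_odd_pow_gauss.
  - apply (continuous_minus (V := R_NormedModule));
      apply (continuous_scal_r (V := R_NormedModule)), continuous_pow_gauss. }
assert (Hlin : is_RInt (fun x => (2 * INR n + 1) * (x ^ (2 * n) * exp (- (x ^ 2)))
    - 2 * (x ^ (2 * (n + 1)) * exp (- (x ^ 2)))) (- z) z
    ((2 * INR n + 1) * u n z - 2 * u (n + 1) z)).
{ apply (is_RInt_minus (V := R_NormedModule));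
    apply (is_RInt_scal (V := R_NormedModule));
    apply (RInt_correct (V := R_CompleteNormedModule)), ex_RInt_pow_gauss. }
apply (is_RInt_unique (V := R_CompleteNormedModule)) in Hftc, Hlin.
(* An odd power times an even function is odd, so the two boundary terms add up to [2 * g z]. *)
assert (Hodd : g (- z) = - g z).
{ unfold g; rewrite !pow_add, !pow_mult.
  replace ((- z) ^ 2) with (z ^ 2) by ring; ring. }
rewrite Hlin, Hodd in Hftc.
change (minus (g z) (- g z)) with (g z - - g z) in Hftc.
unfold g in Hftc; lra.
Qed.

(** The Gaussian is even, so its integral over [[-z, z]] is twice that over [[0, z]], and the
    normalising factor [2 / sqrt PI] of [erf] cancels. *)
Lemma u_0 (z : R) : u 0 z = sqrt PI * erf z.
Proof.
set (f := fun x => exp (- (x ^ 2))).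
assert (Hf : forall a b, ex_RInt f a b).
{ intros a b; apply ex_RInt_ext with (2 := ex_RInt_pow_gauss 0 a b).
  intros x _; unfold f; simpl; ring. }
assert (Heven : RInt f (- z) 0 = RInt f 0 z).
{ rewrite <- (opp_RInt_swap (V := R_CompleteNormedModule)) by apply Hf.
  pose proof (RInt_comp_lin (V := R_CompleteNormedModule) f (-1) 0 0 z
    (Hf _ _)) as Hsub.
  replace (-1 * 0 + 0) with 0 in Hsub by ring.
  replace (-1 * z + 0) with (- z) in Hsub by ring.
  rewrite <- Hsub, (RInt_ext _ (fun x => opp (f x))).
  - rewrite (RInt_opp (V := R_CompleteNormedModule)) by apply Hf.
    apply opp_opp.
  - intros x _; change (-1 * f (-1 * x + 0) = - f x).
    unfold f; replace ((-1 * x + 0) ^ 2) with (x ^ 2) by ring; ring. }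
assert (Hu : u 0 z = RInt f (- z) z).
{ apply RInt_ext; intros x _; unfold f; simpl; ring. }
rewrite Hu, <- (RInt_Chasles (V := R_CompleteNormedModule) f (- z) 0 z), Heven
  by apply Hf.
change (RInt f 0 z + RInt f 0 z = sqrt PI * (2 / sqrt PI * RInt f 0 z)).
field; apply Rgt_not_eq, sqrt_lt_R0, PI_RGT_0.
Qed.

Theorem proposition5 (z : R) (hz : 0 < z) :
  (forall n : nat,
     2 * u (n + 2) z - (2 * INR n + 3 + 2 * z ^ 2) * u (n + 1) z
       + (2 * INR n + 1) * z ^ 2 * u n z = 0)
  /\ u 0 z = sqrt PI * erf z
  /\ u 1 z = sqrt PI / 2 * erf z - z * exp (- (z ^ 2)).
Proof.
split; [intros n|split; [apply u_0|]].
- pose proof (u_step n z) as H1; pose proof (u_step (n + 1) z) as H2.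
  replace (n + 1 + 1)%nat with (n + 2)%nat in H2 by lia.
  (* Splitting the exponent this way exposes the factor [z ^ 2] between consecutive boundary
     terms. *)
  replace (2 * (n + 1) + 1)%nat with (2 * n + 1 + 2)%nat in H2 by lia.
  rewrite plus_INR, pow_add with (n := (2 * n + 1)%nat) in H2.
  simpl (INR 1) in H2; rewrite H2.
  (* Only the part [z ^ 2 * (2 * u (n + 1) z)] is to be expanded by [H1]: its boundary term cancels
     the one from [H2], while [(2 * INR n + 3) * u (n + 1) z] cancels directly. *)
  replace ((2 * INR n + 3 + 2 * z ^ 2) * u (n + 1) z)
    with ((2 * INR n + 3) * u (n + 1) z + z ^ 2 * (2 * u (n + 1) z)) by ring.
  rewrite H1; ring.
- pose proof (u_step 0 z) as H1; rewrite u_0 in H1; simpl (0 + 1)%nat in H1.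
  simpl (INR 0) in H1; rewrite pow_1 in H1; lra.
Qed.
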